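(* Let $\{(x^k,y^k,\lambda^k)\}_{k\ge 0}$ be generated by the proximal ADMM (described in the context) under the stated assumptions on the spaces, operators and functions, and assume the minimization problem has a KKT point. Let $H_*$ be the minimum value of the problem. Then $$|H(x^k,y^k)-H_*|=o\left(\frac1{\sqrt k}\right)\quad\text{and}\quad \|Ax^k+By^k-c\|=o\left(\frac1{\sqrt k}\right)$$ as $k\to\infty$.
   Context: Setting. $\mathcal X,\mathcal Y,\mathcal Z$ are real Hilbert spaces (possibly infinite-dimensional), $c\in\mathcal Z$, $\rho>0$, $A:\mathcal X\to\mathcal Z$ and $B:\mathcal Y\to\mathcal Z$ are bounded linear operators with adjoints $A^*,B^*$, $P:\mathcal X\to\mathcal X$ and $Q:\mathcal Y\to\mathcal Y$ are bounded linear positive semi-definite self-adjoint operators, and $f:\mathcal X\to(-\infty,\infty]$, $g:\mathcal Y\to(-\infty,\infty]$ are proper, lower semi-continuous, convex. For a bounded linear positive semi-definite self-adjoint operator $D$ write $\|u\|_D^2:=\langle u,Du\rangle$. Problem: minimize $H(x,y):=f(x)+g(y)$ subject to $Ax+By=c$. A KKT point is a triple $(\bar x,\bar y,\bar\lambda)\in\mathcal X\times\mathcal Y\times\mathcal Z$ with $-A^*\bar\lambda\in\partial f(\bar x)$, $-B^*\bar\lambda\in\partial g(\bar y)$, $A\bar x+B\bar y=c$. If $(\bar x,\bar y,\bar\lambda)$ is a KKT point then $(\bar x,\bar y)$ solves the problem, and $H_*=H(\bar x,\bar y)$. Proximal ADMM: from an arbitrary initial guess $(x^0,y^0,\lambda^0)\in\mathcal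 X\times\mathcal Y\times\mathcal Z$, for $k\ge0$, $$x^{k+1}\in\arg\min_{x\in\mathcal X}\Big\{f(x)+\langle\lambda^k,Ax\rangle+\tfrac{\rho}{2}\|Ax+By^k-c\|^2+\tfrac12\|x-x^k\|_P^2\Big\},$$ $$y^{k+1}\in\arg\min_{y\in\mathcal Y}\Big\{g(y)+\langle\lambda^k,By\rangle+\tfrac{\rho}{2}\|Ax^{k+1}+By-c\|^2+\tfrac12\|y-y^k\|_Q^2\Big\},$$ $$\lambda^{k+1}=\lambda^k+\rho(Ax^{k+1}+By^{k+1}-c),$$ where it is assumed that minimizers of the subproblems exist, so that the sequence is well defined. *)

(* Defs.v *)
From HB Require Import structures.
From mathcomp Require Import all_boot all_order all_algebra.
From mathcomp Require Import all_classical all_reals all_analysis.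
From mathcomp Require Import ring lra.
Set Implicit Arguments.
Unset Strict Implicit.
Unset Printing Implicit Defensive.
Import Order.TTheory GRing.Theory Num.Theory.
Import numFieldNormedType.Exports.
Local Open Scope classical_set_scope.
Local Open Scope ring_scope.

HB.mixin Record CompleteNormedModule_isHilbert (R : realType) V
    & CompleteNormedModule R V := {
  inner : V -> V -> R ;
  innerC : forall u v : V, inner u v = inner v u ;
  innerDZl : forall (a : R) (u v w : V),
    inner (a *: u + v) w = a * inner u w + inner v w ;
  inner_norm : forall u : V, inner u u = `|u| ^+ 2
}.

#[short(type="hilbertType")]
HB.structure Definition Hilbert (R : realType) :=
  {V of CompleteNormedModule R V & CompleteNormedModule_isHilbert R V}.

Section Inner.
Context {R : realType} {V : hilbertType R}.
Implicit Types (u v w : V) (a : R).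

Lemma innerDl u v w : inner (u + v) w = inner u w + inner v w.
Proof. by rewrite -[u in LHS]scale1r innerDZl mul1r. Qed.

Lemma inner0l w : inner 0 w = 0.
Proof. by have := innerDl 0 0 w; rewrite addr0 => h; lra. Qed.

Lemma innerZl a u w : inner (a *: u) w = a * inner u w.
Proof. by rewrite -[a *: u]addr0 innerDZl inner0l addr0. Qed.

Lemma innerNl u w : inner (- u) w = - inner u w.
Proof. by rewrite -scaleN1r innerZl mulN1r. Qed.

Lemma innerDr u v w : inner w (u + v) = inner w u + inner w v.
Proof. by rewrite !(innerC w) innerDl. Qed.

Lemma innerZr a u w : inner w (a *: u) = a * inner w u.
Proof. by rewrite !(innerC w) innerZl. Qed.

Lemma innerNr u w : inner w (- u) = - inner w u.
Proof. by rewrite !(innerC w) innerNl. Qed.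

Lemma inner_ge0 u : 0 <= inner u u.
Proof. by rewrite inner_norm exprn_ge0. Qed.

Lemma cauchy_schwarz u v : `|inner u v| <= `|u| * `|v|.
Proof.
have [->|v0] := eqVneq v 0; first by rewrite innerC inner0l !normr0 mulr0.
have vv0 : 0 < inner v v by rewrite inner_norm exprn_gt0 // normr_gt0.
have := inner_ge0 (inner v v *: u - inner u v *: v).
rewrite !(innerDl, innerDr, innerNl, innerNr, innerZl, innerZr) (innerC v u) => h.
have {}h : inner u v ^+ 2 <= inner u u * inner v v.
  rewrite -(ler_pM2l vv0); move: h; move: (inner v v) (inner u v) (inner u u).
  by move=> vv uv uu h; rewrite -subr_ge0; move: h; congr (_ <= _); ring.
rewrite -(@ler_pXn2r _ 2) ?nnegrE ?mulr_ge0 //.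
by rewrite exprMn -!inner_norm real_normK // num_real.
Qed.

Lemma riesz (phi : V -> R) (M : R) :
  (forall a u v, phi (a *: u + v) = a * phi u + phi v) ->
  (forall u, `|phi u| <= M * `|u|) ->
  exists w, forall u, phi u = inner u w.
Proof.
move=> philin phiM.
have phiD u v : phi (u + v) = phi u + phi v.
  by rewrite -[u in LHS]scale1r philin mul1r.
have phi0 : phi 0 = 0 by have := phiD 0 0; rewrite addr0 => h; lra.
have phiZ a u : phi (a *: u) = a * phi u.
  by rewrite -[a *: u]addr0 philin phi0 addr0.
pose J u := inner u u - 2 * phi u.
have Jge u : - M ^+ 2 <= J u.
  rewrite /J inner_norm; have := phiM u; rewrite ler_norml => /andP[_ h].
  by have := sqr_ge0 (`|u| - M); move: h; move: (phi u) `|u| => p n h; rewrite expr2; nra.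
have Jinf : has_inf (range J).
  split; first by exists (J 0), 0.
  by exists (- M ^+ 2) => _ [u _ <-].
pose m := inf (range J).
have mJ u : m <= J u by apply: ge_inf; [case: Jinf|exists u].
have /choice[x xm] : forall n : nat, exists u, J u < m + n.+1%:R^-1.
  move=> n; have [||_ [u _ <-] h] := @inf_adherent _ (range J) n.+1%:R^-1.
  - by rewrite invr_gt0.
  - exact: Jinf.
  - by exists u.
have xx n k : `|x n - x k| ^+ 2 <= 2 * n.+1%:R^-1 + 2 * k.+1%:R^-1.
  have := mJ (2^-1 *: (x n + x k)); have := xm n; have := xm k.
  rewrite -inner_norm /J !(innerDl, innerDr, innerNl, innerNr, innerZl, innerZr).
  rewrite phiZ phiD (innerC (x k) (x n)).
  by move: (n.+1%:R^-1) (k.+1%:R^-1) (inner _ _) (inner _ _) (inner _ _) => *; lra.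
have inv_small (e : R) : 0 < e -> \forall n \near \oo, n.+1%:R^-1 < e.
  by move=> e0; near=> n; near: n; exact: near_infty_natSinv_lt (PosNum e0).
have /cauchy_cvgP/cvg_ex[w xw] : cauchy (x @ \oo).
  apply: cauchy_exP => e e0.
  have e20 : 0 < e ^+ 2 / 4 by rewrite divr_gt0 // exprn_gt0.
  have [N _ hN] := inv_small _ e20.
  exists (x N); exists N => // n /= Nn.
  rewrite -ball_normE /ball_ /=.
  rewrite -(@ltr_pXn2r _ 2) ?nnegrE ?(ltW e0) //.
  apply: le_lt_trans (xx N n) _.
  by have := hN N (leqnn N); have := hN n Nn => /=;
    move: (N.+1%:R^-1) (n.+1%:R^-1) (e ^+ 2) => *; lra.
exists w => v.
pose d := inner w v - phi v.
have dt t : 0 <= 2 * t * d + t ^+ 2 * inner v v.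
  apply/ler_addgt0Pl => e e0.
  pose K := 2 * `|t| * `|v| + 1.
  have K0 : 0 < K by rewrite ltr_wpDl // !mulr_ge0.
  near \oo => n.
  have hn1 : n.+1%:R^-1 < e / 2 by near: n; apply: inv_small; lra.
  have hn2 : `|w - x n| < e / 2 / K.
    by near: n; move: xw => /cvgrPdist_lt; apply; rewrite !divr_gt0.
  have := mJ (x n + t *: v); have := xm n; rewrite /J.
  rewrite !(innerDl, innerDr, innerZl, innerZr) phiD phiZ (innerC v).
  have : `|2 * t * inner (w - x n) v| <= e / 2.
    apply: le_trans (_ : `|w - x n| * K <= _); last first.
      by rewrite -ler_pdivlMr // ltW.
    rewrite !normrM (@ger0_norm _ 2) // /K mulrDr mulr1.
    apply: le_trans (_ : 2 * `|t| * (`|w - x n| * `|v|) <= _).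
      by rewrite ler_wpM2l ?mulr_ge0 ?cauchy_schwarz.
    by have := normr_ge0 (w - x n); nra.
  rewrite ler_norml innerDl innerNl => /andP[h1 h2] h3 h4.
  move: hn1 h1 h3 h4; rewrite /d.
  move: (n.+1%:R^-1) (phi v) (inner w v) (inner (x n) v) (inner v v) => r p a b s.
  by move=> *; lra.
suff : d = 0 by rewrite /d (innerC w); lra.
have s0 : 0 < inner v v + 1 by have := inner_ge0 v; lra.
have := dt (- d / (inner v v + 1)).
set s := inner v v + 1 in s0 *.
have -> : 2 * (- d / s) * d + (- d / s) ^+ 2 * inner v v
          = - (d ^+ 2 * (s + 1) / s ^+ 2).
  have -> : inner v v = s - 1 by rewrite /s addrK.
  by field; exact: lt0r_neq0.
rewrite oppr_ge0 => h; apply/eqP; rewrite -sqrf_eq0; apply/eqP/le_anti.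
rewrite sqr_ge0 andbT.
move: h; rewrite ler_pdivrMr ?exprn_gt0 // mul0r.
by rewrite pmulr_lle0 //; lra.
Unshelve. all: by end_near. Qed.

End Inner.

Definition bounded_operator {R : realType} {V W : normedModType R}
    (A : V -> W) :=
  exists M : R, forall u, `|A u| <= M * `|u|.

Section Operators.
Context {R : realType}.

(* By [adjointP] the default value 0 is never used when A is a bounded linear
   operator. *)
Definition adjoint {V W : hilbertType R} (A : V -> W) (w : W) : V :=
  xget 0 [set v | forall u, inner (A u) w = inner u v].

Lemma adjointP {V W : hilbertType R} (A : {linear V -> W}) :
  bounded_operator A ->
  forall u w, inner (A u) w = inner u (adjoint A w).
Proof.
move=> [M AM] u w.
suff [v hv] : exists v, forall u, inner (A u) w = inner u v.
  exact: (@xgetPex _ 0 [set v | forall u, inner (A u) w = inner u v]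
           (ex_intro _ v hv) u).
apply: (@riesz _ _ _ (M * `|w|)) => [a s t|s].
  by rewrite linearP innerDZl.
apply: le_trans (cauchy_schwarz _ _) _.
by rewrite mulrAC ler_wpM2r.
Qed.

Definition self_adjoint {V : hilbertType R} (D : V -> V) :=
  forall u v, inner (D u) v = inner u (D v).

Definition positive_semidefinite {V : hilbertType R} (D : V -> V) :=
  forall u, 0 <= inner u (D u).

Definition sqnorm_of {V : hilbertType R} (D : V -> V) (u : V) : R :=
  inner u (D u).

End Operators.

Section ConvexAnalysis.
Context {R : realType}.
Local Open Scope ereal_scope.

Definition proper_function {T : Type} (f : T -> \bar R) :=
  (forall u, -oo < f u) /\ exists u, f u < +oo.

(* In \bar R, 0 * +oo = 0, so the endpoints t = 0 and t = 1 are harmless. *)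
Definition convex_efunction {V : lmodType R} (f : V -> \bar R) :=
  forall (u v : V) (t : R), (0 <= t <= 1)%R ->
    f (t *: u + (1 - t) *: v)%R <= t%:E * f u + (1 - t)%:E * f v.

Definition subdifferential {V : hilbertType R} (f : V -> \bar R) (u : V)
    : set V :=
  [set s | forall v, f u + (inner s (v - u)%R)%:E <= f v].

Definition argmin {T : Type} (F : T -> \bar R) : set T :=
  [set u | forall v, F u <= F v].

End ConvexAnalysis.

Section Problem.
Context {R : realType} {X Y Z : hilbertType R}.
Variables (f : X -> \bar R) (g : Y -> \bar R).
Variables (A : X -> Z) (B : Y -> Z) (c : Z).

Definition objective (x : X) (y : Y) : \bar R := (f x + g y)%E.

Definition is_minimum_value (h : \bar R) :=
  (exists x y, A x + B y = c /\ objective x y = h) /\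
  (forall x y, A x + B y = c -> (h <= objective x y)%E).

Definition is_KKT_point (x : X) (y : Y) (lambda : Z) :=
  [/\ subdifferential f x (- adjoint A lambda),
      subdifferential g y (- adjoint B lambda) &
      A x + B y = c].

Definition proximal_ADMM (rho : R) (P : X -> X) (Q : Y -> Y)
    (x : nat -> X) (y : nat -> Y) (lambda : nat -> Z) :=
  forall k : nat,
  [/\ argmin (fun u : X => f u + (inner (lambda k) (A u)
        + rho / 2 * `|A u + B (y k) - c| ^+ 2
        + 1 / 2 * sqnorm_of P (u - x k))%:E)%E (x k.+1),
      argmin (fun v : Y => g v + (inner (lambda k) (B v)
        + rho / 2 * `|A (x k.+1) + B v - c| ^+ 2
        + 1 / 2 * sqnorm_of Q (v - y k))%:E)%E (y k.+1) &
      lambda k.+1 = lambda k + rho *: (A (x k.+1) + B (y k.+1) - c)].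

End Problem.

(* Main.v *)
Require Import Defs.
From mathcomp Require Import all_boot all_order all_algebra.
From mathcomp Require Import all_classical all_reals all_analysis.
From mathcomp Require Import zify ring lra.
Set Implicit Arguments.
Unset Strict Implicit.
Unset Printing Implicit Defensive.
Import Order.TTheory GRing.Theory Num.Theory.
Import numFieldNormedType.Exports.
Local Open Scope classical_set_scope.
Local Open Scope ring_scope.

(** Write a state as w = (x, y, lambda).  By the first-order optimality
    conditions of the two subproblems, an iteration is a step w -> w' of a
    monotone inclusion ([admm_step], [proximal_ADMM_step]), and a KKT point is
    a state z with a step z -> z.  Measure states by the positive semidefinite
    form
      <w, w'> = <x, P x'> + <y, Q y'> + rho <B y, B y'> + <l, l'> / rho
    ([admm_form]).

    Monotonicity of the subdifferentials, applied to any two steps u -> u' and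
    v -> v', bounds the form of d := (u' - v') - (u - v) against u' - v' by the
    cross term <B d_y, d_lambda> ([admm_step_monotone]).  Completing a square
    gives that steps are nonexpansive, so that
      D_k := |w_(k+1) - w_k|^2
    is nonincreasing and |w_k - z| is bounded.  For v = v' = z, the cross term
    is instead bounded by means of two consecutive y-steps
    ([cross_le_sqnorm]); this yields a nonnegative Lyapunov quantity that drops
    by at least D_k at each step ([admm_step_lyapunov]).  A nonincreasing
    summable D_k satisfies (k + 1) D_k -> 0 ([lyapunov_decrease_harmonic]).

    It remains to bound both quantities by a constant times sqrt D_k.  The
    residual is (lambda_(k+1) - lambda_k) / rho.  The objective gap is bounded
    below by the subgradient inequality at the KKT point, in terms of the
    residual only, and above by the subgradient inequality at the iterate, in
    terms of the residual, the cross term, and the form of w_(k+1) - w_k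
    against w_(k+1) - z, to which Cauchy-Schwarz applies
    ([objective_gap_le_increment]). *)

(** * Subgradients *)

Lemma inner_adjointl {R : realType} {V W : hilbertType R}
    (M : {linear V -> W}) w v :
  bounded_operator M -> inner (adjoint M w) v = inner w (M v).
Proof. by move=> Mb; rewrite innerC -adjointP // innerC. Qed.

Section Subgradients.
Context {R : realType} {V : hilbertType R}.

(** Divide by t and let t tend to 0: this is how first-order optimality is
    read off along a segment. *)
Lemma ge0_first_order (a q : R) :
  (forall t, 0 < t <= 1 -> 0 <= t * a + t ^+ 2 * q) -> 0 <= a.
Proof.
move=> h; rewrite leNgt; apply/negP => a0.
have s0 : 0 < - a + `|q| + 1 by have := normr_ge0 q; lra.
(* t := - a / s makes a + t q < 0 when a < 0, since |q| < s; the term - a in s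
   keeps t <= 1. *)
set s := - a + `|q| + 1 in s0.
have t0 : 0 < - a / s by rewrite divr_gt0 // oppr_gt0.
have t1 : - a / s <= 1 by rewrite ler_pdivrMr // mul1r /s; have := normr_ge0 q; lra.
have := h (- a / s); rewrite t0 t1 => /(_ isT).
rewrite expr2 -mulrA -mulrDr pmulr_rge0 //.
have -> : a + - a / s * q = (- a) * (- s + q) / s by field; rewrite gt_eqF.
rewrite pmulr_lge0 ?invr_gt0 // pmulr_rge0 ?oppr_gt0 //.
by have := ler_norm q; rewrite /s; lra.
Qed.

Lemma proper_argmin_fin_num (f : V -> \bar R) (h : V -> R) u :
  proper_function f -> argmin (fun v => f v + (h v)%:E)%E u ->
  f u \is a fin_num.
Proof.
move=> [fgt [v fv]] /(_ v) hu.
rewrite fin_numElt fgt /=.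
have : (f u + (h u)%:E < +oo)%E.
  by apply: le_lt_trans hu _; rewrite lte_add_pinfty // ltry.
by case: (f u) => // a _; rewrite ltry.
Qed.

Lemma subdifferential_fin_num (f : V -> \bar R) u s :
  proper_function f -> subdifferential f u s -> f u \is a fin_num.
Proof.
move=> [fgt [v fv]] /(_ v) hu.
rewrite fin_numElt fgt /=.
by move: (le_lt_trans hu fv); case: (f u) => // a _; rewrite ltry.
Qed.

Lemma subdifferentialP (f : V -> \bar R) u v s :
  proper_function f -> subdifferential f u s -> f v \is a fin_num ->
  fine (f u) + inner s (v - u) <= fine (f v).
Proof.
move=> pf su fv; have fu := subdifferential_fin_num pf su.
by rewrite -lee_fin EFinD !fineK //; exact: su.
Qed.

Lemma subdifferential_monotone (f : V -> \bar R) u v s t :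
  proper_function f -> subdifferential f u s -> subdifferential f v t ->
  0 <= inner (s - t) (u - v).
Proof.
move=> pf su tv.
have := subdifferentialP pf su (subdifferential_fin_num pf tv).
have := subdifferentialP pf tv (subdifferential_fin_num pf su).
rewrite !(innerDl, innerDr, innerNl, innerNr); lra.
Qed.

(** Fermat's rule for the subproblems.  Moving from the minimizer u to
    u + t (v - u), the quadratic part changes by t times its derivative plus
    t^2 times a constant, while convexity bounds the change of f by
    t (f v - f u); hence f v - f u dominates minus the derivative.  Only the
    increments of the residual r enter, so that one lemma serves both
    blocks. *)
Lemma argmin_prox_subdifferential {W : hilbertType R} (f : V -> \bar R)
    (M : {linear V -> W}) (r : V -> W) (D : {linear V -> V}) (l : W) (rho : R)
    (u0 u : V) :
  proper_function f -> convex_efunction f -> bounded_operator M ->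
  self_adjoint D -> (forall v w, r v - r w = M (v - w)) ->
  argmin (fun v => f v + (inner l (M v) + rho / 2 * `|r v| ^+ 2
                          + 1 / 2 * sqnorm_of D (v - u0))%:E)%E u ->
  subdifferential f u (- adjoint M (l + rho *: r u) - D (u - u0)).
Proof.
move=> pf cf Mb Dsa rM umin v.
have fu := proper_argmin_fin_num pf umin.
have [/eqP ->|fv_oo] := boolP (f v == +oo%E); first by rewrite leey.
have fv : f v \is a fin_num.
  by rewrite fin_numElt (proj1 pf) /= ltey.
rewrite -(fineK fu) -(fineK fv) -EFinD lee_fin -subr_ge0.
rewrite innerDl !innerNl (innerC (adjoint _ _)) -adjointP // .
set d := v - u.
apply: (@ge0_first_order _ (rho / 2 * inner (M d) (M d) + 1 / 2 * inner d (D d))).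
move=> t /andP[t0 t1].
have := cf v u t; rewrite (ltW t0) t1 => /(_ isT).
have -> : t *: v + (1 - t) *: u = u + t *: d.
  by rewrite /d scalerBr scalerBl scale1r addrCA.
have := umin (u + t *: d).
have -> : u + t *: d - u0 = (u - u0) + t *: d by rewrite addrAC.
have -> : r (u + t *: d) = r u + t *: M d.
  rewrite -[r (u + t *: d)](subrK (r u)) rM addrC; congr (_ + _).
  by rewrite addrAC subrr add0r linearZ.
move: (u - u0) => e; clearbody d.
rewrite -(fineK fu) -(fineK fv) -!inner_norm /sqnorm_of.
rewrite !(linearD M) !(linearD D) !(linearZ_LR M) !(linearZ_LR D) /=.
have : f (u + t *: d) != -oo%E by rewrite gt_eqF // (proj1 pf).
case: (f (u + t *: d)) => [a| |] _ //.
rewrite -!EFinM -!EFinD !lee_fin.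
rewrite !(innerDl, innerDr, innerNl, innerNr, innerZl, innerZr).
rewrite (innerC (M d) l) (innerC (M d) (r u)).
rewrite -(Dsa e d) (innerC d (D e)).
nra.
Qed.

End Subgradients.

(** * Convergence rates of real sequences *)

Section Rates.
Context {R : realType}.
Implicit Types D L u : nat -> R.

(** Since L converges, its decrease over the window from k/2 to k vanishes;
    that decrease dominates the sum of D over the window, which is at least
    (k/2) D_k because D is nonincreasing. *)
Lemma lyapunov_decrease_harmonic D L :
  nonincreasing_seq D -> (forall k, 0 <= D k) -> (forall k, 0 <= L k) ->
  (forall k, L k.+1 + D k.+1 <= L k) ->
  (fun k => k.+1%:R * D k) @ \oo --> (0 : R).
Proof.
move=> Dd D0 L0 LD.
have LB m j : j%:R * D (m + j)%N <= L m - L (m + j)%N.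
  elim: j => [|j IH]; first by rewrite mul0r addn0 subrr.
  have := LD (m + j)%N; rewrite addnS -natr1.
  have := ler_wpM2l (ler0n R j) (Dd _ _ (leqnSn (m + j))).
  move: IH; lra.
have Lcvg : cvgn L.
  apply: nonincreasing_is_cvgn; last by exists 0 => _ [k _ <-].
  by apply/nonincreasing_seqP => k; have := LD k; have := D0 k.+1; lra.
have half_oo : half @ \oo --> \oo.
  move=> S [N _ hN]; exists N.*2 => // k /= hk.
  by apply: hN => /=; rewrite -[N]doubleK half_leq.
have Lhalf : (fun k => 4 * (L k./2 - L k)) @ \oo --> (0 : R).
  rewrite -[0](mulr0 4) -(subrr (limn L)).
  by apply: cvgMr; apply: cvgB => //; apply: cvg_comp half_oo _.
apply: squeeze_cvgr (cvg_cst 0) Lhalf.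
near=> k; rewrite mulr_ge0 //=.
have k1 : (0 < k)%N by near: k; exists 1%N.
have := LB k./2 (k - k./2)%N.
have -> : (k./2 + (k - k./2) = k)%N by lia.
have : k.+1%:R * D k <= 4 * ((k - k./2)%N%:R * D k).
  rewrite mulrA ler_wpM2r // -natrM ler_nat; lia.
lra.
Unshelve. all: by end_near. Qed.

(** The bound relates u at k + 1 to D at k: D measures the step that produces
    the iterate k + 1, and nothing is known of the initial one. *)
Lemma littleo_inv_sqrt u D (C : R) :
  (fun k => k.+1%:R * D k) @ \oo --> (0 : R) ->
  (forall k, `|u k.+1| <= C * Num.sqrt (D k)) ->
  u =o_\oo (fun k => (Num.sqrt k%:R)^-1 : R).
Proof.
move=> D0 uD; apply/eqoP => e e0.
have C1 : 0 < `|C| + 1 by rewrite ltr_wpDl.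
pose q := e / (`|C| + 1); have q0 : 0 < q by rewrite divr_gt0.
move/cvgrPdist_le : D0 => /(_ _ (exprn_gt0 2 q0)) [N _ hN].
exists N.+1 => // -[//|k] /= Nk.
have := hN k Nk; rewrite /= sub0r normrN => hk.
rewrite [`|_^-1|]ger0_norm ?invr_ge0 ?sqrtr_ge0 // ler_pdivlMr ?sqrtr_gt0 ?ltr0n //.
apply: le_trans (ler_wpM2r (sqrtr_ge0 _) (uD k)) _.
rewrite -mulrA [_ * Num.sqrt _]mulrC -sqrtrM ?ler0n //.
have : Num.sqrt (k.+1%:R * D k) <= q.
  rewrite -(ger0_norm (ltW q0)) -sqrtr_sqr ler_wsqrtr //.
  exact: le_trans (ler_norm _) hk.
rewrite ler_pdivlMr // mulrC; apply: le_trans.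
by rewrite ler_wpM2r ?sqrtr_ge0 //; have := ler_norm C; lra.
Qed.

End Rates.

(** * One step of the algorithm *)

Section Step.
Context {R : realType} {X Y Z : hilbertType R}.
Variables (f : X -> \bar R) (g : Y -> \bar R).
Variables (A : {linear X -> Z}) (B : {linear Y -> Z}) (c : Z) (rho : R).
Variables (P : {linear X -> X}) (Q : {linear Y -> Y}).
Hypothesis rho_gt0 : 0 < rho.
Hypotheses (A_bounded : bounded_operator A) (B_bounded : bounded_operator B).
Hypotheses (P_sa : self_adjoint P) (P_psd : positive_semidefinite P).
Hypotheses (Q_sa : self_adjoint Q) (Q_psd : positive_semidefinite Q).
Hypotheses (f_proper : proper_function f) (g_proper : proper_function g).

Local Notation state := (X * Y * Z)%type.

Definition admm_form (w w' : state) : R :=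
  inner w.1.1 (P w'.1.1) + inner w.1.2 (Q w'.1.2)
  + rho * inner (B w.1.2) (B w'.1.2) + rho^-1 * inner w.2 w'.2.

(** In the x-block, the multiplier lambda + rho (A x' + B y - c) of the
    subproblem is rewritten as lambda' - rho B (y' - y).  In this form a KKT
    point is exactly a state with a step to itself. *)
Definition admm_step (w w' : state) : Prop :=
  [/\ subdifferential f w'.1.1
        (- adjoint A (w'.2 - rho *: B (w'.1.2 - w.1.2)) - P (w'.1.1 - w.1.1)),
      subdifferential g w'.1.2 (- adjoint B w'.2 - Q (w'.1.2 - w.1.2)) &
      w'.2 - w.2 = rho *: (A w'.1.1 + B w'.1.2 - c)].

Lemma admm_formC w w' : admm_form w w' = admm_form w' w.
Proof.
rewrite /admm_form -P_sa -Q_sa (innerC (P _)) (innerC (Q _)) (innerC (B _)).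
by rewrite (innerC w.2).
Qed.

Lemma admm_formDZl a w1 w2 w :
  admm_form (a *: w1 + w2) w = a * admm_form w1 w + admm_form w2 w.
Proof.
by rewrite /admm_form /= (linearP B) !innerDZl; ring.
Qed.

Lemma admm_form_ge0 w : 0 <= admm_form w w.
Proof.
rewrite /admm_form addr_ge0 ?addr_ge0 ?P_psd ?Q_psd //.
  by rewrite mulr_ge0 ?inner_ge0 ?ltW.
by rewrite mulr_ge0 ?inner_ge0 ?invr_ge0 ?ltW.
Qed.

Lemma admm_form_polarization u v :
  2 * admm_form (v - u) v =
  admm_form v v - admm_form u u + admm_form (v - u) (v - u).
Proof.
have wB w1 w2 w : admm_form (w1 - w2) w = admm_form w1 w - admm_form w2 w.
  by rewrite addrC -scaleN1r admm_formDZl mulN1r addrC.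
rewrite wB (wB v u (v - u)) !(admm_formC _ (v - u)) !wB (admm_formC u v); ring.
Qed.

Lemma admm_form_cauchy_schwarz u v :
  `|admm_form u v| <= Num.sqrt (admm_form u u) * Num.sqrt (admm_form v v).
Proof.
have h t : 0 <= admm_form v v * t ^+ 2 + 2 * admm_form u v * t + admm_form u u.
  have := admm_form_ge0 (t *: v + u).
  rewrite admm_formDZl !(admm_formC _ (_ + _)) !admm_formDZl (admm_formC v u).
  by congr (_ <= _); ring.
rewrite -sqrtrM ?admm_form_ge0 // -sqrtr_sqr ler_wsqrtr //.
have := deg_le2_poly_ge0 (size_Poly [:: admm_form u u; 2 * admm_form u v;
  admm_form v v]).
rewrite !coef_Poly /= => disc.
suff : (2 * admm_form u v) ^+ 2 - 4 * admm_form v v * admm_form u u <= 0 by lra.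
apply: disc => t.
rewrite !horner_cons hornerC; have := h t; apply: etrans; congr (_ <= _); ring.
Qed.

Lemma dual_le_admm_form (w : state) : rho^-1 * `|w.2| ^+ 2 <= admm_form w w.
Proof.
rewrite -inner_norm /admm_form.
have := P_psd w.1.1; have := Q_psd w.1.2.
have : 0 <= rho * inner (B w.1.2) (B w.1.2) by rewrite mulr_ge0 ?inner_ge0 ?ltW.
lra.
Qed.

Lemma cross_le_admm_form (w : state) : 2 * inner (B w.1.2) w.2 <= admm_form w w.
Proof.
rewrite /admm_form.
have := P_psd w.1.1; have := Q_psd w.1.2.
have := inner_ge0 (rho *: B w.1.2 - w.2).
rewrite !(innerDl, innerDr, innerNl, innerNr, innerZl, innerZr).
rewrite (innerC w.2 (B _)).
move: (inner (B _) (B _)) (inner (B _) w.2) (inner w.2 w.2) => a b d h.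
suff : 0 <= rho * a - 2 * b + rho^-1 * d by lra.
have -> : rho * a - 2 * b + rho^-1 * d
  = rho^-1 * (rho ^+ 2 * a - 2 * rho * b + d) by field; rewrite gt_eqF.
by rewrite pmulr_rge0 ?invr_gt0 //; move: h; congr (_ <= _); ring.
Qed.

Lemma KKT_admm_step xb yb lb :
  is_KKT_point f g A B c xb yb lb -> admm_step (xb, yb, lb) (xb, yb, lb).
Proof.
move=> [fx gy feas]; split => /=.
all: rewrite !subrr ?(linear0 B) ?(linear0 P) ?(linear0 Q) ?scaler0 ?subr0 //.
by rewrite feas subrr scaler0.
Qed.

Lemma admm_step_residual u u' v v' : admm_step u u' -> admm_step v v' ->
  (u' - v').2 - (u - v).2 = rho *: (A (u' - v').1.1 + B (u' - v').1.2).
Proof.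
move=> [_ _ hu] [_ _ hv].
rewrite /= opprB [v.2 - u.2]addrC addrACA [- v'.2 + _]addrC -[v.2 - v'.2]opprB hu hv.
rewrite -scalerBr.
congr (_ *: _); rewrite (linearB A) (linearB B).
by rewrite opprB subrKA opprD addrACA.
Qed.

(** The sum of the monotonicity inequalities of the subdifferentials of f and g
    at u' and v'.  The residual identity eliminates A x: the coupling terms
    then assemble into the rho <B y, B y'> and <l, l'> / rho parts of the form,
    and the single term left over is the right-hand side. *)
Lemma admm_step_monotone u u' v v' : admm_step u u' -> admm_step v v' ->
  admm_form ((u' - v') - (u - v)) (u' - v') <=
  inner (B ((u' - v') - (u - v)).1.2) ((u' - v') - (u - v)).2.
Proof.
move=> su sv; have hl := admm_step_residual su sv.
case: su sv => [fu gu _] [fv gv _].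
have := subdifferential_monotone g_proper gu gv.
have := subdifferential_monotone f_proper fu fv.
have Az : A (u' - v').1.1
    = rho^-1 *: ((u' - v').2 - (u - v).2) - B (u' - v').1.2.
  by rewrite hl scalerA mulVf ?gt_eqF // scale1r addrK.
have -> : ((u' - v') - (u - v)).2 = (u' - v').2 - (u - v).2 by [].
rewrite /admm_form -!P_sa -!Q_sa /= in Az hl *.
have -> : inner (u'.2 - v'.2 - (u.2 - v.2)) (u'.2 - v'.2)
  = inner (u'.2 - v'.2) (u'.2 - v'.2 - (u.2 - v.2)) by exact: innerC.
rewrite !(innerDl, innerNl) !inner_adjointl // Az.
move: (B (u'.1.2 - v'.1.2)) => bz.
move: (u'.2 - v'.2 - (u.2 - v.2)) => e.
rewrite !(linearB B) !(linearB P) !(linearB Q).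
rewrite !(innerDl, innerNl, innerZl) !(innerDr, innerNr, innerZr).
have rV t : rho * (rho^-1 * t) = t by rewrite mulrA mulfV ?mul1r ?gt_eqF.
have rV' t : rho^-1 * (rho * t) = t by rewrite mulrA mulVf ?mul1r ?gt_eqF.
rewrite !(mulrDr, mulrN, rV, rV').
lra.
Qed.

(** By polarization, twice the form of d := (u' - v') - (u - v) against
    u' - v' is |u' - v'|^2 - |u - v|^2 + |d|^2, and the last square absorbs
    the cross term. *)
Lemma admm_step_nonexpansive u u' v v' : admm_step u u' -> admm_step v v' ->
  admm_form (u' - v') (u' - v') <= admm_form (u - v) (u - v).
Proof.
move=> su sv; have := admm_step_monotone su sv.
have := admm_form_polarization (u - v) (u' - v').
have := cross_le_admm_form ((u' - v') - (u - v)).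
lra.
Qed.

(** Monotonicity of the subdifferential of g at two consecutive iterates.  It
    trades the cross term for a telescoping difference; absorbing it into
    |w - v|^2 as in nonexpansiveness would leave nothing to sum. *)
Lemma cross_le_sqnorm u v w : admm_step u v -> admm_step v w ->
  2 * inner (B (w - v).1.2) (w - v).2 <=
  sqnorm_of Q (v - u).1.2 - sqnorm_of Q (w - v).1.2.
Proof.
move=> [_ gv _] [_ gw _].
have := subdifferential_monotone g_proper gw gv.
have := Q_psd ((w.1.2 - v.1.2) - (v.1.2 - u.1.2)).
rewrite /sqnorm_of /= (innerC (B _)) -!Q_sa.
rewrite !(innerDl _ _ (w.1.2 - v.1.2)) !(innerNl _ (w.1.2 - v.1.2)).
rewrite !inner_adjointl //.
move: (w.1.2 - v.1.2) (v.1.2 - u.1.2) => d e.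
rewrite !(linearB Q) !(innerDl, innerNl, innerDr, innerNr) (Q_sa e d) (innerC e).
rewrite !inner_adjointl //; lra.
Qed.

(** The distance to the KKT point alone need not decrease by the squared step
    length; adding the Q-norm of the last y-increment compensates for the
    cross term. *)
Lemma admm_step_lyapunov u v w z :
  admm_step u v -> admm_step v w -> admm_step z z ->
  admm_form (w - z) (w - z) + sqnorm_of Q (w - v).1.2
  + admm_form (w - v) (w - v) <=
  admm_form (v - z) (v - z) + sqnorm_of Q (v - u).1.2.
Proof.
move=> suv svw szz.
have := admm_step_monotone svw szz; have := admm_form_polarization (v - z) (w - z).
have -> : w - z - (v - z) = w - v by rewrite opprB subrKA.
have := cross_le_sqnorm suv svw.
lra.
Qed.

(** The subgradients of f and g at z are - A^* z_lambda and - B^* z_lambda, so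
    their contributions combine into the product of z_lambda and the
    residual. *)
Lemma objective_gap_lower w w' z : admm_step w w' -> admm_step z z ->
  - (rho^-1 * inner z.2 (w' - w).2) <=
  fine (f w'.1.1) + fine (g w'.1.2) - (fine (f z.1.1) + fine (g z.1.2)).
Proof.
move=> sw sz; have := admm_step_residual sw sz.
case: sw sz => [fw gw _] [fz gz _].
have := subdifferentialP f_proper fz (subdifferential_fin_num f_proper fw).
have := subdifferentialP g_proper gz (subdifferential_fin_num g_proper gw).
have -> : (w' - z).2 - (w - z).2 = (w' - w).2 by rewrite /= opprB subrKA.
move=> + + ->; rewrite innerZr mulKf ?gt_eqF //= !subrr.
rewrite (linear0 B) (linear0 P) (linear0 Q) scaler0 !subr0 (innerDr (A _)) !innerNl.
rewrite !inner_adjointl //; lra.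
Qed.

(** The subgradient inequalities at the new iterate, tested at z.  Eliminating
    A x as in [admm_step_monotone] produces the form with w'.2 in place of
    w'.2 - z.2; the difference is the first term on the right. *)
Lemma objective_gap_upper w w' z : admm_step w w' -> admm_step z z ->
  fine (f w'.1.1) + fine (g w'.1.2) - (fine (f z.1.1) + fine (g z.1.2)) <=
  - (rho^-1 * inner z.2 (w' - w).2) + inner (B (w' - w).1.2) (w' - w).2
  - admm_form (w' - w) (w' - z).
Proof.
move=> sw sz; have := admm_step_residual sw sz.
case: sw sz => [fw gw _] [fz gz _].
have := subdifferentialP f_proper fw (subdifferential_fin_num f_proper fz).
have := subdifferentialP g_proper gw (subdifferential_fin_num g_proper gz).
have -> : (w' - z).2 - (w - z).2 = (w' - w).2 by rewrite /= opprB subrKA.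
move=> gzw fzw hl.
have Az : A (w' - z).1.1 = rho^-1 *: (w' - w).2 - B (w' - z).1.2.
  by rewrite hl scalerA mulVf ?gt_eqF // scale1r addrK.
move: gzw fzw; clear hl.
rewrite /admm_form -P_sa -Q_sa /= in Az *.
rewrite (innerC (w'.2 - w.2) (w'.2 - z.2)).
rewrite -(opprB w'.1.2 z.1.2) -(opprB w'.1.1 z.1.1).
rewrite !innerNr !(innerDl, innerNl) !inner_adjointl // Az.
move: (w'.2 - w.2) (B (w'.1.2 - z.1.2)) => e bz.
rewrite (linearB B) !(innerDl, innerNl, innerZl) !(innerDr, innerNr, innerZr).
have rV t : rho * (rho^-1 * t) = t by rewrite mulrA mulfV ?mul1r ?gt_eqF.
rewrite !(mulrDr, mulrN, rV).
lra.
Qed.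

(** * The sequence of iterates *)

Section Orbit.
Variables (w : nat -> state) (z : state).
Hypothesis w_step : forall k, admm_step (w k) (w k.+1).
Hypothesis z_fix : admm_step z z.

Let increment k := admm_form (w k.+1 - w k) (w k.+1 - w k).

Lemma increment_nonincreasing : nonincreasing_seq increment.
Proof.
apply/nonincreasing_seqP => k.
exact: admm_step_nonexpansive (w_step k.+1) (w_step k).
Qed.

Lemma increment_harmonic :
  (fun k => k.+1%:R * increment k) @ \oo --> (0 : R).
Proof.
apply: (@lyapunov_decrease_harmonic _ _ (fun k =>
  admm_form (w k.+1 - z) (w k.+1 - z) + sqnorm_of Q (w k.+1 - w k).1.2)).
- exact: increment_nonincreasing.
- by move=> k; exact: admm_form_ge0.
- by move=> k; rewrite addr_ge0 ?admm_form_ge0 ?Q_psd.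
- by move=> k; exact: admm_step_lyapunov.
Qed.

Lemma residual_le_increment k :
  `|A (w k.+1).1.1 + B (w k.+1).1.2 - c|
  <= Num.sqrt rho^-1 * Num.sqrt (increment k).
Proof.
have [_ _ hl] := w_step k.
have := dual_le_admm_form (w k.+1 - w k); rewrite /= hl normrZ exprMn.
rewrite (gtr0_norm rho_gt0) mulrA expr2 mulKf ?gt_eqF // -/(increment k) => h.
rewrite -sqrtrM ?invr_ge0 ?(ltW rho_gt0) //.
rewrite -[leLHS]normr_id -sqrtr_sqr ler_wsqrtr //.
by rewrite -ler_pdivrMl ?invr_gt0 // invrK.
Qed.

Lemma objective_gap_le_increment : exists C : R, forall k,
  `|fine (f (w k.+1).1.1) + fine (g (w k.+1).1.2)
    - (fine (f z.1.1) + fine (g z.1.2))| <= C * Num.sqrt (increment k).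
Proof.
exists (`|z.2| * Num.sqrt rho^-1 + 2^-1 * Num.sqrt (increment 0)
        + Num.sqrt (admm_form (w 0%N - z) (w 0%N - z))) => k.
have := objective_gap_upper (w_step k) z_fix.
have := objective_gap_lower (w_step k) z_fix.
have [_ _ hl] := w_step k.
have -> : rho^-1 * inner z.2 (w k.+1 - w k).2
          = inner z.2 (A (w k.+1).1.1 + B (w k.+1).1.2 - c).
  by rewrite /= hl innerZr mulKf ?gt_eqF.
move=> lo up.
have dual : `|inner z.2 (A (w k.+1).1.1 + B (w k.+1).1.2 - c)|
            <= `|z.2| * Num.sqrt rho^-1 * Num.sqrt (increment k).
  apply: le_trans (cauchy_schwarz _ _) _.
  by rewrite -mulrA ler_wpM2l // residual_le_increment.
have cross : inner (B (w k.+1 - w k).1.2) (w k.+1 - w k).2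
             <= 2^-1 * Num.sqrt (increment 0) * Num.sqrt (increment k).
  have := cross_le_admm_form (w k.+1 - w k); rewrite -/(increment k).
  have : increment k <= Num.sqrt (increment 0) * Num.sqrt (increment k).
    rewrite -[leLHS]sqr_sqrtr ?admm_form_ge0 // expr2 ler_wpM2r ?sqrtr_ge0 //.
    by rewrite ler_wsqrtr // increment_nonincreasing.
  lra.
have dist : admm_form (w k.+1 - z) (w k.+1 - z) <= admm_form (w 0%N - z) (w 0%N - z).
  elim: k.+1 => // j IH; apply: le_trans IH.
  exact: admm_step_nonexpansive.
have err : `|admm_form (w k.+1 - w k) (w k.+1 - z)|
    <= Num.sqrt (admm_form (w 0%N - z) (w 0%N - z)) * Num.sqrt (increment k).
  apply: le_trans (admm_form_cauchy_schwarz _ _) _.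
  by rewrite mulrC ler_wpM2r ?sqrtr_ge0 // ler_wsqrtr.
have sD := sqrtr_ge0 (increment k).
have s0 : 0 <= 2^-1 * Num.sqrt (increment 0) * Num.sqrt (increment k).
  by rewrite !mulr_ge0 ?sqrtr_ge0.
have e0 : 0 <= Num.sqrt (admm_form (w 0%N - z) (w 0%N - z)) * Num.sqrt (increment k).
  by rewrite mulr_ge0 ?sqrtr_ge0.
move: dual err; rewrite !ler_norml !mulrDl => /andP[d1 d2] /andP[e1 e2].
move: up cross s0 e0 d1 d2 e1 e2 lo.
move: (Num.sqrt (increment k)) (Num.sqrt (increment 0)) (Num.sqrt rho^-1) => a b d.
move: (Num.sqrt _) (admm_form _ _) (inner (B _) _) (inner _ _) => *.
by apply/andP; split; lra.
Qed.

End Orbit.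

Lemma proximal_ADMM_step (f_convex : convex_efunction f)
    (g_convex : convex_efunction g) x y lambda k :
  proximal_ADMM f g A B c rho P Q x y lambda ->
  admm_step (x k, y k, lambda k) (x k.+1, y k.+1, lambda k.+1).
Proof.
move=> /(_ k)[xmin ymin lE]; split => /=; last by rewrite lE addrC addKr.
- have -> : lambda k.+1 - rho *: B (y k.+1 - y k)
            = lambda k + rho *: (A (x k.+1) + B (y k) - c).
    rewrite lE -addrA -scalerBr (linearB B); congr (_ + _ *: _).
    by rewrite addrAC opprB -(addrA (A _)) subrKC.
  apply: (argmin_prox_subdifferential (r := fun u => A u + B (y k) - c)
            f_proper f_convex A_bounded P_sa _ xmin) => u v.
  by rewrite (linearB A) opprB subrKA opprD addrACA subrr addr0.
- rewrite lE.
  apply: (argmin_prox_subdifferential (r := fun v => A (x k.+1) + B v - c)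
            g_proper g_convex B_bounded Q_sa _ ymin) => u v.
  by rewrite (linearB B) opprB subrKA opprD addrACA subrr add0r.
Qed.

Lemma KKT_minimum_value xb yb lb (h : \bar R) :
  is_KKT_point f g A B c xb yb lb -> is_minimum_value f g A B c h ->
  h = (fine (f xb) + fine (g yb))%:E.
Proof.
move=> [fx gy feas] [[x0 [y0 [feas0 <-]]] hmin].
have fb := subdifferential_fin_num f_proper fx.
have gb := subdifferential_fin_num g_proper gy.
rewrite EFinD !fineK //; apply/eqP; rewrite eq_le hmin // andTb.
have := leeD (fx x0) (gy y0).
rewrite addeACA -EFinD !innerNl !inner_adjointl // -opprD -innerDr.
(* Both points are feasible, so the linear terms cancel. *)
have -> : A (x0 - xb) + B (y0 - yb) = 0.
  by rewrite (linearB A) (linearB B) addrACA -opprD feas0 feas subrr.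
by rewrite innerC inner0l oppr0 adde0.
Qed.

End Step.

Theorem theorem2p6 (R : realType) (X Y Z : hilbertType R)
    (f : X -> \bar R) (g : Y -> \bar R)
    (A : {linear X -> Z}) (B : {linear Y -> Z}) (c : Z) (rho : R)
    (P : {linear X -> X}) (Q : {linear Y -> Y})
    (x : nat -> X) (y : nat -> Y) (lambda : nat -> Z) (Hmin : \bar R)
    (rho_gt0 : 0 < rho)
    (A_bounded : bounded_operator A) (B_bounded : bounded_operator B)
    (P_bounded : bounded_operator P) (P_sa : self_adjoint P)
    (P_psd : positive_semidefinite P)
    (Q_bounded : bounded_operator Q) (Q_sa : self_adjoint Q)
    (Q_psd : positive_semidefinite Q)
    (f_proper : proper_function f) (f_lsc : lower_semicontinuous f)
    (f_convex : convex_efunction f)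
    (g_proper : proper_function g) (g_lsc : lower_semicontinuous g)
    (g_convex : convex_efunction g)
    (admm : proximal_ADMM f g A B c rho P Q x y lambda)
    (kkt : exists xbar ybar lbar, is_KKT_point f g A B c xbar ybar lbar)
    (Hmin_min : is_minimum_value f g A B c Hmin) :
  [/\ (* the gap is eventually finite, so that taking fine below is lossless *)
      \forall k \near \oo,
        (`|objective f g (x k) (y k) - Hmin|)%E \is a fin_num,
      (fun k : nat => fine (`|objective f g (x k) (y k) - Hmin|)%E)
        =o_\oo (fun k : nat => (Num.sqrt k%:R)^-1 : R) &
      (fun k : nat => `|A (x k) + B (y k) - c|)
        =o_\oo (fun k : nat => (Num.sqrt k%:R)^-1 : R)].
Proof.
have [xb [yb [lb kkt_b]]] := kkt.
pose w k := (x k, y k, lambda k); pose z := (xb, yb, lb).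
have w_step k : admm_step f g A B c rho P Q (w k) (w k.+1).
  exact: proximal_ADMM_step.
have z_fix : admm_step f g A B c rho P Q z z by exact: KKT_admm_step.
have rate := increment_harmonic rho_gt0 A_bounded B_bounded P_sa P_psd Q_sa
  Q_psd f_proper g_proper w_step z_fix.
have gapE k : (`|objective f g (x k.+1) (y k.+1) - Hmin|)%E
    = `|fine (f (x k.+1)) + fine (g (y k.+1)) - (fine (f xb) + fine (g yb))|%:E.
  have [fx gy _] := w_step k.
  rewrite (KKT_minimum_value A_bounded B_bounded f_proper g_proper kkt_b Hmin_min).
  rewrite /objective -(fineK (subdifferential_fin_num f_proper fx)).
  by rewrite -(fineK (subdifferential_fin_num g_proper gy)).
split.
(* Index 0 is excluded: the initial guess may have an infinite objective. *)
- by exists 1%N => // -[//|k] _ /=; rewrite gapE.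
- have [C hC] := objective_gap_le_increment rho_gt0 A_bounded B_bounded P_sa
    P_psd Q_sa Q_psd f_proper g_proper w_step z_fix.
  by apply: littleo_inv_sqrt rate _ => k; rewrite gapE /= normr_id; exact: hC.
- apply: littleo_inv_sqrt rate _ => k; rewrite normr_id.
  exact: (residual_le_increment rho_gt0 P_psd Q_psd w_step).
Qed.
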